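(* Every regular ($T_1$) Alster space is weakly Alster.
   Context: A family $\mathcal G$ of $G_\delta$ subsets of a space $X$ is an Alster covering of $X$ if for every compact $K\subset X$ there is $G\in\mathcal G$ with $K\subset G$. $X$ is an Alster space if every Alster covering of $X$ has a countable subcovering (a countable subfamily whose union is $X$). Alster spaces are Lindelöf, so a regular $T_1$ Alster space is Tychonoff and can be regarded as a subspace of its Čech–Stone compactification $\beta X$. $X$ is weakly Alster if for every family $\mathcal G$ of $G_\delta$ subsets of $\beta X$ such that $\{G\cap X:G\in\mathcal G\}$ is an Alster covering of $X$, there is a $\sigma$-compact $Y\subset\beta X$ such that $X\subset Y\subset\bigcup\mathcal G$. *)

(* Defs.v *)
From HB Require Import structures.
From mathcomp Require Import all_boot all_order all_algebra.
From mathcomp Require Import all_classical all_reals all_analysis.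
From mathcomp Require Import borel_hierarchy.

Set Implicit Arguments.
Unset Strict Implicit.
Unset Printing Implicit Defensive.

Import Order.TTheory GRing.Theory Num.Theory.
Import numFieldNormedType.Exports.

Local Open Scope classical_set_scope.
Local Open Scope ring_scope.

Definition alster_covering (X : topologicalType) (G : set (set X)) : Prop :=
  (forall A, G A -> Gdelta A) /\
  (forall K : set X, compact K -> exists2 A, G A & K `<=` A).

Definition alster_space (X : topologicalType) : Prop :=
  forall G : set (set X), alster_covering G ->
  exists H : set (set X),
    [/\ H `<=` G, countable H & \bigcup_(A in H) A = [set: X]].

Definition sigma_compact (T : topologicalType) (Y : set T) : Prop :=
  exists2 K : (set T)^nat, (forall n, compact (K n)) & Y = \bigcup_n K n.

Definition topological_embedding (X Y : topologicalType) (f : X -> Y) : Prop :=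
  injective f /\
  (forall U : set X, open U <-> exists2 V : set Y, open V & U = f @^-1` V).

Section stone_cech.
Context (R : realType) (X : topologicalType).

Definition unit_fun : Type :=
  {f : X -> R | continuous f /\ forall x, f x \in `[0, 1]}.

Definition stone_cech_eval (x : X) : {ptws unit_fun -> R} :=
  fun f => sval f x.

(* The closure is taken in the power of R rather than of [0, 1]; this makes no
   difference, the cube being closed. *)
Definition stone_cech : topologicalType :=
  set_type (closure (range stone_cech_eval)).

Lemma stone_cech_eval_closure (x : X) :
  stone_cech_eval x \in closure (range stone_cech_eval).
Proof. by apply/mem_set/subset_closure; exists x. Qed.

Definition to_stone_cech (x : X) : stone_cech :=
  exist _ (stone_cech_eval x) (stone_cech_eval_closure x).

End stone_cech.

(* The notion only makes sense when X is a subspace of its compactification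
   (equivalently, X is Tychonoff): this is the first conjunct.  The trace of A on
   X is then the preimage of A. *)
Definition weakly_alster_space (R : realType) (X : topologicalType) : Prop :=
  topological_embedding (@to_stone_cech R X) /\
  forall G : set (set (stone_cech R X)),
    (forall A, G A -> Gdelta A) ->
    alster_covering [set @to_stone_cech R X @^-1` A | A in G] ->
    exists Y : set (stone_cech R X),
      [/\ sigma_compact Y, range (@to_stone_cech R X) `<=` Y
        & Y `<=` \bigcup_(A in G) A].

Section stone_cech_theory.
Context (R : realType) (X : topologicalType).
Local Notation e := (@to_stone_cech R X).
Local Notation I := {classic (unit_fun R X)}.

Lemma set_val_continuous (T : topologicalType) (A : set T) :
  continuous (set_val : A -> T).
Proof. exact: initial_continuous. Qed.

Lemma stone_cech_proj_continuous (i : unit_fun R X) :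
  continuous (fun z : stone_cech R X => set_val z i : R).
Proof.
move=> z; apply: (@continuous_comp _ _ _ set_val (fun g : {ptws unit_fun R X -> R} => g i)).
  exact: set_val_continuous.
exact: (@proj_continuous I (fun=> R) i).
Qed.

Lemma to_stone_cech_continuous : continuous e.
Proof.
apply/continuousP => _ [B oB <-].
have ce : continuous (@stone_cech_eval R X).
  move=> x; apply/cvg_sup => i U /= [_ [[V oV <-] Vx VU]].
  have [ci _] := svalP i.
  by apply: filterS VU _; apply: ci; exact: open_nbhs_nbhs.
by move/continuousP: ce; apply.
Qed.

Lemma stone_cech_hausdorff : hausdorff_space (stone_cech R X).
Proof.
move=> p q pq; apply: val_inj.
apply: (@hausdorff_product I (fun=> R)); first by move=> _; exact: Rhausdorff.
move=> A B nA nB.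
have [z [Az Bz]] := pq _ _ (set_val_continuous nA) (set_val_continuous nB).
by exists (set_val z).
Qed.

Lemma dense_range_to_stone_cech : dense (range e).
Proof.
move=> O [z Oz] [B oB BO]; rewrite -BO in Oz *.
have [_ [[x _ <-] Bx]] := set_mem (valP z) _ (open_nbhs_nbhs (conj oB Oz)).
by exists (e x); split => //; exists x.
Qed.

Lemma stone_cech_compact : compact [set: stone_cech R X].
Proof.
pose C : set {ptws unit_fun R X -> R} := [set g | forall i, `[0, 1]%classic (g i)].
have cC : compact C.
  by apply: (@tychonoff I (fun=> R) (fun=> `[0, 1]%classic)) => _; exact: segment_compact.
have hP : hausdorff_space {ptws unit_fun R X -> R}.
  by apply: (@hausdorff_product I (fun=> R)) => _; exact: Rhausdorff.
have sC : closure (range (@stone_cech_eval R X)) `<=` C.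
  have /closure_id -> : closed C by exact: compact_closed.
  by apply: closure_subset => _ [x _ <-] i; case: (svalP i) => _; apply.
have cA : compact (closure (range (@stone_cech_eval R X))).
  exact: subclosed_compact (@closed_closure _ _) cC sC.
move=> F FF _.
have FA : (set_val @ F) (closure (range (@stone_cech_eval R X))).
  apply: (@filterS _ F _ setT); last exact: filterT.
  by move=> z _; exact: set_mem (svalP z).
have [p [Ap clp]] := cA _ _ FA.
exists (exist _ p (mem_set Ap)); split => // U V FU [_ [[B oB <-] Bp BV]].
have FU' : (set_val @ F) (set_val @` U).
  apply: (@filterS _ F _ U) FU.
  by move=> z Uz; exists z.
have [_ [[z Uz <-] Bz]] := clp _ _ FU' (open_nbhs_nbhs (conj oB Bp)).
by exists z; split => //; exact: BV.
Qed.

Lemma stone_cech_extension (f : X -> R) :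
  continuous f -> (forall x, f x \in `[0, 1]) ->
  exists2 g : stone_cech R X -> R, continuous g & forall x, g (e x) = f x.
Proof.
move=> cf f01; exists (fun z => set_val z (exist _ f (conj cf f01))) => //.
exact: stone_cech_proj_continuous.
Qed.

End stone_cech_theory.

(* Main.v *)
From HB Require Import structures.
Require Import Defs.
From mathcomp Require Import all_boot all_order all_algebra.
From mathcomp Require Import all_classical all_reals all_analysis.
From mathcomp Require Import finmap borel_hierarchy.

Set Implicit Arguments.
Unset Strict Implicit.
Unset Printing Implicit Defensive.

Import Order.TTheory GRing.Theory Num.Theory.
Import numFieldNormedType.Exports.

Local Open Scope classical_set_scope.
Local Open Scope ring_scope.

(** An Alster space is Lindelof ([alster_lindelof]): the finite unions of
    members of an open cover are open, hence G_delta, and every compact set lies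
    in one of them, so countably many of them cover.  A regular Lindelof space is normal
    ([regular_lindelof_normal]), and so, with points closed, completely regular;
    this makes the canonical map into the Stone-Cech compactification an
    embedding ([to_stone_cech_embedding]).

    For the covering property, the point is that an Alster covering by traces
    of G_delta sets can be refined to one by traces of closed G_delta sets.
    The compactification bX is compact Hausdorff, hence normal, so whenever the
    image of a compact K lies in a G_delta set A of bX, a closed G_delta set Z
    fits in between ([closed_sub_Gdelta]).  Each Z is compact and the traces of
    these Z still form an Alster covering of X; the union of countably many Z
    whose traces cover X is the required sigma-compact set. *)

Definition lindelof_space (X : topologicalType) : Prop :=
  forall F : set (set X), (forall A, F A -> open A) ->
  \bigcup_(A in F) A = [set: X] ->
  exists H : set (set X),
    [/\ H `<=` F, countable H & \bigcup_(A in H) A = [set: X]].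

(** The empty set serves as padding, so that an empty family, or a finite one,
    needs no separate treatment. *)
Lemma countable_family_seq (T : Type) (H : set (set T)) : countable H ->
  exists2 U : (set T)^nat,
    \bigcup_n U n = \bigcup_(A in H) A & forall n, H (U n) \/ U n = set0.
Proof.
move=> /countable_injP[f fI].
have /choice[U UP] : forall n, exists A : set T,
    (H A /\ f A = n) \/ (A = set0 /\ forall B, H B -> f B <> n).
  move=> n; have [[A HA]|nH] := pselect (exists A, H A /\ f A = n).
    by exists A; left.
  by exists set0; right; split=> // B HB fB; apply: nH; exists B.
exists U => [|n]; last by case: (UP n) => [[]|[]]; [left|right].
apply/seteqP; split=> [x [n _ Ux]|x [A HA Ax]].
  by case: (UP n) => [[HU _]|[U0 _]]; [exists (U n)|rewrite U0 in Ux].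
exists (f A) => //; case: (UP (f A)) => [[HU fU]|[_ /(_ A HA)]]; last by [].
by have -> : U (f A) = A by apply: fI => //; exact: mem_set.
Qed.

(** An element of K serves as the base point that [compact_cover] asks for; if K
    has none, the empty subcover works. *)
Lemma compact_cover_compact (X : topologicalType) (K : set X) :
  compact K -> cover_compact K.
Proof.
have [->|/set0P[x _]] := eqVneq K set0.
  by move=> _ I D f _ _; exists fset0%fset.
pose X' : ptopologicalType := HB.pack (X : Type) X (isPointed.Build X x).
move=> cK; suff : @cover_compact X' K by [].
by rewrite -compact_cover.
Qed.

Lemma alster_lindelof (X : topologicalType) :
  alster_space X -> lindelof_space X.
Proof.
move=> alX F oF Fcov.
pose G := [set \bigcup_(A in [set` D]) A | D in
             [set D : {fset (set X)}%fset | [set` D] `<=` F]].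
have alG : alster_covering G.
  split=> [_ [D DF <-]|K cK].
    by apply: open_Gdelta; apply: bigcup_open => A /DF /oF.
  have /(_ (set X) F id oF) := compact_cover_compact cK.
  case=> [|D DF KD]; first by rewrite /cover Fcov.
  by exists (\bigcup_(A in [set` D]) A) => //; exists D => // A /DF /set_mem.
have [H [HG cH Hcov]] := alX G alG.
have /choice[D DP] : forall B, exists D : {fset (set X)}%fset,
    H B -> [set` D] `<=` F /\ \bigcup_(A in [set` D]) A = B.
  move=> B; have [/HG[D DF DB]|nHB] := pselect (H B); first by exists D.
  by exists fset0.
exists (\bigcup_(B in H) [set` D B]); split.
- by move=> A [B HB DA]; exact: (DP B HB).1.
- by apply: bigcup_countable => // B _; exact: countable_fset.
- apply/seteqP; split=> // x _.
  have [B HB] : (\bigcup_(A in H) A) x by rewrite Hcov.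
  by rewrite -(DP B HB).2 => -[A DA Ax]; exists A => //; exists B.
Qed.

(** Given disjoint closed A and B, regularity covers X by open sets whose
    closure misses A or B; by the Lindelof property a sequence U of them covers.
    From each U n whose closure misses B are removed the closures of those U k
    with k <= n whose closure misses A.  The union of what is left still contains
    A, as only sets disjoint from A were removed.  The same with A and B
    exchanged gives an open set containing B.  The two open sets are disjoint:
    a common point would lie in some U n and some U m, one of each kind, and the
    one of smaller index has been removed from the other. *)
Lemma regular_lindelof_normal (R : realType) (X : topologicalType) :
  regular_space X -> lindelof_space X -> normal_space X.
Proof.
move=> regX linX; apply/(@normal_openP R) => A B clA clB AB0.
pose F := [set U : set X | open U /\
  (closure U `&` A = set0 \/ closure U `&` B = set0)].
have FE (x : X) (C : set X) : closed C -> ~ C x ->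
    exists U, [/\ open U, U x & closure U `&` C = set0].
  move=> clC nCx; have [|V Vx VC] := regX x (~` C).
    by apply: open_nbhs_nbhs; split=> //; exact: closed_openC.
  exists V°; split; [exact: open_interior|exact: Vx|].
  apply/disjoints_subset/(subset_trans _ VC).
  by apply: closureS; exact: interior_subset.
have [||H [HF cH Hcov]] := linX F; first by move=> U [].
  apply/seteqP; split=> // x _; have [Ax|nAx] := pselect (A x).
    have nBx : ~ B x by move=> Bx; have : (A `&` B) x by []; rewrite AB0.
    by have [U [oU Ux UB]] := FE _ _ clB nBx; exists U => //; split=> //; right.
  by have [U [oU Ux UA]] := FE _ _ clA nAx; exists U => //; split=> //; left.
have [U UE UP] := countable_family_seq cH.
have oU n : open (U n).
  by case: (UP n) => [/HF[]//|->]; exact: open0.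
have UAB n : closure (U n) `&` A = set0 \/ closure (U n) `&` B = set0.
  case: (UP n) => [/HF[]//|->]; left.
  by rewrite closure0 set0I.
pose peel C D := \bigcup_(n in [set n | closure (U n) `&` D = set0])
  (U n `\` \bigcup_(k in [set k | (k <= n)%N /\ closure (U k) `&` C = set0])
     closure (U k)).
have open_peel C D : open (peel C D).
  apply: bigcup_open => n _; rewrite setDE; apply: openI => //.
  apply: closed_openC.
  apply: closed_bigcup => [|k _]; last exact: closed_closure.
  by apply: (sub_finite_set _ (finite_II n.+1)) => k [].
have sub_peel C D : (forall n, closure (U n) `&` C = set0 \/
    closure (U n) `&` D = set0) -> C `<=` peel C D.
  move=> UCD x Cx.
  have nclC n : closure (U n) `&` C = set0 -> ~ closure (U n) x.
    by move=> UC0 Ux; have : (closure (U n) `&` C) x by []; rewrite UC0.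
  have [n _ Ux] : (\bigcup_n U n) x by rewrite UE Hcov.
  exists n; last by split=> // -[k [_ /nclC]].
  by case: (UCD n) => // /nclC; case; exact: subset_closure.
exists (peel A B), (peel B A); split=> //.
- exact: sub_peel.
- by apply: sub_peel => n; case: (UAB n); [right|left].
- rewrite -subset0 => x [[n nB [Unx nUn]] [m mA [Umx nUm]]].
  have [mn|/ltnW nm] := leqP m n.
    by apply: nUn; exists m => //; exact: subset_closure.
  by apply: nUm; exists n => //; exact: subset_closure.
Qed.

(** Normality yields open W 0, W 1, ... around K with
    closure (W n.+1) contained in both W n and V n, where G is the intersection
    of the V n.  The intersection of the W n is then G_delta, and it is closed
    because it equals the intersection of the closures. *)
Lemma closed_sub_Gdelta (T : topologicalType) (K G : set T) :
  normal_space T -> closed K -> Gdelta G -> K `<=` G ->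
  exists Z, [/\ closed Z, Gdelta Z, K `<=` Z & Z `<=` G].
Proof.
move=> nT clK [V oV ->] KG.
have shrink (nW : nat * set T) : exists W', open nW.2 /\ K `<=` nW.2 ->
    [/\ open W', K `<=` W' & closure W' `<=` nW.2 `&` V nW.1].
  case: nW => n W /=.
  have [[oW KW]|] := pselect (open W /\ K `<=` W); last by exists set0.
  have /(nT _ clK)[W1 /set_nbhsP[C [oC KC CW1]] W1W] : set_nbhs K (W `&` V n).
    apply/set_nbhsP; exists (W `&` V n); split => //; first exact: openI.
    by move=> x Kx; split; [exact: KW|exact: KG].
  by exists C => _; split=> //; apply: subset_trans W1W; exact: closureS.
have [s sP] := choice shrink.
pose W := fix W n := if n is m.+1 then s (m, W m) else [set: T].
have WP n : open (W n) /\ K `<=` W n.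
  elim: n => [|n IHn]; first by split=> //; exact: openT.
  by have [] := sP (n, W n) IHn.
have clW n : closure (W n.+1) `<=` W n `&` V n by have [] := sP (n, W n) (WP n).
exists (\bigcap_n W n); split.
- suff -> : \bigcap_n W n = \bigcap_n closure (W n.+1).
    by apply: closed_bigI => n _; exact: closed_closure.
  apply/seteqP; split=> x Wx n _; first exact/subset_closure/Wx.
  exact: (clW n x (Wx n I)).1.
- by exists W => // n; exact: (WP n).1.
- by move=> x Kx n _; exact: (WP n).2.
- by move=> x Wx n _; apply: (clW n x _).2; exact/subset_closure/Wx.
Qed.

Lemma Gdelta_preimage (S T : topologicalType) (f : S -> T) (A : set T) :
  continuous f -> Gdelta A -> Gdelta (f @^-1` A).
Proof.
move=> cf [V oV ->]; exists (fun n => f @^-1` V n) => [n|].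
  by move/continuousP : cf; apply.
by rewrite preimage_bigcap.
Qed.

(** A continuous function that is 0 at x and 1 off an open U extends to bX, and
    the points of bX where the extension is below 1 form an open set around the
    image of x whose trace lies in U.  Injectivity follows, as open sets
    separate points. *)
Lemma to_stone_cech_embedding (R : realType) (X : topologicalType) :
  accessible_space X -> completely_regular_space X ->
  topological_embedding (@to_stone_cech R X).
Proof.
move=> T1 crX; set e := @to_stone_cech R X.
have openE U : open U <-> exists2 V, open V & U = e @^-1` V.
  split=> [oU|[V oV ->]]; last first.
    by have /continuousP := @to_stone_cech_continuous R X; apply.
  exists (\bigcup_(V in [set V | open V /\ e @^-1` V `<=` U]) V).
    by apply: bigcup_open => V [].
  apply/seteqP; split=> [x Ux|x [V [_ VU] Vx]]; last exact: VU.
  have /crX : closed (~` U) by exact: open_closedC.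
  move=> /(_ x) /(_ (fun n => n Ux)) /(@uniform_separatorP _ R).
  case=> f [cf f01 /imsub1P fx /imsub1P fU].
  have [|g cg gE] := stone_cech_extension cf.
    by move=> y; apply: f01; exists y.
  exists (g @^-1` [set r | r < 1]).
    split; first by move/continuousP : cg; apply; exact: open_lt.
    move=> y /=; rewrite gE => fy1; apply: contrapT => /fU /= fy.
    by rewrite fy ltxx in fy1.
  by rewrite /= gE (fx x erefl) ltr01.
split=> // x y exy; apply: contrapT => /eqP /T1[U [/openE[V _ ->]]].
by move=> /set_mem/= Vx /set_mem/=; rewrite -exy.
Qed.

Theorem proposition4p3 (R : realType) (X : topologicalType) :
  accessible_space X -> regular_space X -> alster_space X ->
  weakly_alster_space R X.
Proof.
move=> T1 regX alX; split.
  apply: to_stone_cech_embedding => //; apply: normal_completely_regular => //.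
  exact: regular_lindelof_normal (alster_lindelof alX).
set e := @to_stone_cech R X => G GdG [_ alG].
have hB := @stone_cech_hausdorff R X; have cB := @stone_cech_compact R X.
have ce := @to_stone_cech_continuous R X.
have nB := compact_normal hB cB.
pose ZZ := [set Z | [/\ closed Z, Gdelta Z & exists2 A, G A & Z `<=` A]].
have [|H [HZ cH Hcov]] := alX [set e @^-1` Z | Z in ZZ].
  split=> [_ [Z [_ dZ _] <-]|K cK]; first exact: Gdelta_preimage.
  have [_ [A GA <-] KA] := alG K cK.
  have [|||Z [clZ dZ KZ ZA]] := @closed_sub_Gdelta _ (e @` K) A nB.
  - apply: compact_closed => //; apply: continuous_compact => //.
    exact: continuous_subspaceT.
  - exact: GdG.
  - by move=> _ [x Kx <-]; exact: KA.
  exists (e @^-1` Z); first by exists Z => //; split=> //; exists A.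
  by move=> x Kx; apply: KZ; exists x.
have /choice[z zP] : forall B, exists Z, H B -> ZZ Z /\ e @^-1` Z = B.
  move=> B; have [/HZ[Z ? ?]|nHB] := pselect (H B); first by exists Z.
  by exists set0.
have [|U UE UP] := @countable_family_seq _ (z @` H).
  exact: sub_countable (card_image_le _ _) cH.
exists (\bigcup_n U n); split.
- exists U => // n; case: (UP n) => [[B HB <-]|->]; last exact: compact0.
  by have [[clZ _ _] _] := zP B HB; exact: subclosed_compact cB _.
- move=> _ [x _ <-]; rewrite UE bigcup_image.
  have [B HB Bx] : (\bigcup_(A in H) A) x by rewrite Hcov.
  by exists B => //; have [_ zB] := zP B HB; rewrite -zB in Bx.
- rewrite UE bigcup_image => y [B HB zy].
  by have [[_ _ [A GA ZA]] _] := zP B HB; exists A => //; exact: ZA.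
Qed.
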